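(* Assume $\alpha>0$, $\beta>0$, $\mu_N>0$ and $N\ge2$ fixed. The continuous-time Markov chain $y(t)$ on $\Gamma$ is ergodic: it has a unique stationary distribution $\pi$ on $\Gamma$, and there exist constants $C_1,C_2>0$ such that for all $t\ge0$ and every initial distribution of $y(0)$, $$\sum_{y\in\Gamma}|\mathbf P(y(t)=y)-\pi(y)|\le C_1e^{-C_2t}.$$
   Context: Particle system: $x(t)=(x_1(t),\dots,x_N(t))$ is the continuous-time Markov chain on $\mathbf Z^N$ in which each particle independently jumps $+1$ at rate $\alpha$ and $-1$ at rate $\beta$, and for each ordered pair $(i,j)$, $j\ne i$, at rate $\mu_N/N$ particle $i$ is moved to position $x_j$ if $x_i>x_j$ (generator $G_Ng(x)=\sum_i[\alpha(g(x+e_i)-g(x))+\beta(g(x-e_i)-g(x))]+\sum_i\sum_{j\ne i}(g(x-(x_i-x_j)e_i)-g(x))\mathbf 1\{x_i>x_j\}\mu_N/N$). Relative coordinates: $y_i(t)=x_i(t)-\min_j x_j(t)$, $y(t)=(y_1(t),\dots,y_N(t))$, which is a Markov chain on $\Gamma=\bigcup_k\Gamma_k\subset\mathbf Z_+^N$, $\Gamma_k=\{z\in\mathbf Z_+^N: z_k=0\}$. *)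

(* Defs.v *)
From HB Require Import structures.
From mathcomp Require Import all_boot all_order all_algebra.
From mathcomp Require Import all_classical all_reals all_analysis.

Set Implicit Arguments.
Unset Strict Implicit.
Unset Printing Implicit Defensive.

Import Order.TTheory GRing.Theory Num.Theory.
Local Open Scope ring_scope.
Local Open Scope classical_set_scope.

Definition state (N : nat) := {ffun 'I_N -> nat}.

Definition Gam (N : nat) : set (state N) := [set y | exists k : 'I_N, y k = 0%N].
Arguments Gam : clear implicits.

(* relative coordinates: x_i - min_j x_j  (the default of the big min is x k
   itself, which is one of the terms, so this is the true minimum). *)
Definition normalize (N : nat) (x : 'I_N -> int) : state N :=
  [ffun k => `|x k - \big[Num.min/x k]_(i < N) x i|%N].

(* elementary transitions of the x-chain:
   inl (inl i) : particle i jumps +1      (rate alpha)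
   inl (inr i) : particle i jumps -1      (rate beta)
   inr (i, j)  : particle i moved to x_j if x_i > x_j  (rate mu_N / N, i <> j) *)
Definition move (N : nat) := (('I_N + 'I_N) + ('I_N * 'I_N))%type.

(* effect of a move on the relative coordinates (x chain is translation
   invariant, so we apply it to the representative x = y and renormalize). *)
Definition step (N : nat) (m : move N) (y : state N) : state N :=
  let x := fun k : 'I_N => ((y k)%:Z : int) in
  match m with
  | inl (inl i) => normalize (fun k => x k + ((nat_of_bool (k == i))%:Z))
  | inl (inr i) => normalize (fun k => x k - ((nat_of_bool (k == i))%:Z))
  | inr (i, j) => normalize (fun k => if (k == i) && (x j < x i) then x j else x k)
  end.

Definition rate (R : realType) (alpha beta mu : R) (N : nat) (m : move N) : R :=
  match m with
  | inl (inl _) => alpha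
  | inl (inr _) => beta
  | inr (i, j) => if i != j then mu / N%:R else 0
  end.

Definition total_rate (R : realType) (alpha beta mu : R) (N : nat) : R :=
  \sum_(m : move N) rate alpha beta mu m.

Definition run (N : nat) (s : seq (move N)) (y : state N) : state N :=
  foldl (fun z m => step m z) y s.

(* Transition function P_t(x, z) of the continuous-time chain y(t):
   each move m rings at the times of an independent Poisson clock of rate
   rate m (the generator G_N); conditioning on the total number k of rings
   (Poisson(total_rate * t)) and their marks gives
   P_t(x,z) = sum_k e^{-lambda t} t^k/k! sum_{m_1..m_k} prod rate(m_i) [run = z]
   (= exp(tQ) for this bounded-rate generator). *)
Definition trans (R : realType) (alpha beta mu : R) (N : nat) (t : R)
    (x z : state N) : \bar R :=
  \esum_(k in [set: nat])
    ((expR (- total_rate alpha beta mu N * t) * t ^+ k / (k`!)%:R) *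
     \sum_(s : k.-tuple (move N))
        ((\prod_(m <- s) rate alpha beta mu m) * (run s x == z)%:R))%:E.

Definition law (R : realType) (alpha beta mu : R) (N : nat)
    (nu : state N -> R) (t : R) (z : state N) : \bar R :=
  (\esum_(x in Gam N) (nu x)%:E * @trans R alpha beta mu N t x z)%E.

Definition is_distribution (R : realType) (N : nat) (nu : state N -> R) : Prop :=
  (forall x, 0 <= nu x) /\ \esum_(x in Gam N) (nu x)%:E = 1%E.

Definition stationary (R : realType) (alpha beta mu : R) (N : nat)
    (pi : state N -> R) : Prop :=
  is_distribution pi /\
  forall t : R, 0 <= t -> forall z, Gam N z ->
    law alpha beta mu pi t z = (pi z)%:E.

(* Main.v *)
Require Import Defs.
From HB Require Import structures.
From mathcomp Require Import all_boot all_order all_algebra.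
From mathcomp Require Import finmap.
From mathcomp Require Import all_classical all_reals all_analysis.
From mathcomp Require Import ring lra.
Import Order.TTheory GRing.Theory Num.Theory.
Import numFieldNormedType.Exports.
Local Open Scope ring_scope.
Local Open Scope classical_set_scope.

(** Uniformization writes the transition semigroup at time [t] as the mixture,
    over a Poisson number [k] of rings, of the powers [K^k] of a discrete kernel
    [K].  From a state with a zero coordinate [j], the word of moves "[i] jumps
    to [j]", [i] ranging over the other particles, leads to the zero state, so
    [K^(N-1)] charges that state with a probability bounded below uniformly in
    the starting point (Doeblin's condition).  Hence the oscillation of [K^n f]
    decays geometrically, uniformly in [0 <= f <= 1]; the limit of [K^n f] is the
    integral of [f] against the stationary distribution, and averaging a
    geometric rate over the Poisson weights gives an exponential one.  Only
    functions are iterated: total variation is recovered by testing against the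
    indicators of finite sets. *)

(** * Nonnegative extended sums through finite lists *)

Section ExtendedSums.
Context {R : realType} {T : choiceType}.
Local Open Scope ereal_scope.

Lemma esum_le_seq (S : set T) (a : T -> \bar R) (c : \bar R) :
  (forall s : seq T, uniq s -> (forall x, x \in s -> S x) ->
    \sum_(x <- s) a x <= c) -> \esum_(x in S) a x <= c.
Proof.
move=> h; apply: ge_ereal_sup => _ [X [finX XS] <-].
rewrite fsbig_finite//; apply: h; first exact: fset_uniq.
by move=> x; rewrite in_fset_set// inE => /XS.
Qed.

Lemma esum_ge_seq (S : set T) (a : T -> \bar R) (s : seq T) :
  uniq s -> (forall x, x \in s -> S x) ->
  \sum_(x <- s) a x <= \esum_(x in S) a x.
Proof.
move=> us sS; apply: esum_ge; exists [set` s]; first by split=> //; exact: finite_seq.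
by rewrite fsbig_seq.
Qed.

Lemma ge0_esumZl (S : set T) (a : T -> \bar R) (c : R) : (0 <= c)%R ->
  (forall x, S x -> 0 <= a x) ->
  \esum_(x in S) (c%:E * a x) = c%:E * \esum_(x in S) a x.
Proof.
move=> c0 a0.
have sumM (d : R) (b : T -> \bar R) s : (forall x, S x -> 0 <= b x) ->
    (forall x, x \in s -> S x) ->
    \sum_(x <- s) (d%:E * b x) = d%:E * \sum_(x <- s) b x.
  move=> b0 sS; rewrite big_seq [in RHS]big_seq -ge0_sume_distrr// => x xs.
  exact/b0/sS.
apply/eqP; rewrite eq_le; apply/andP; split.
  apply: esum_le_seq => s us sS; rewrite sumM//.
  by apply: lee_wpmul2l; [rewrite lee_fin|exact: esum_ge_seq].
(* The converse bound divides by [c], so [c = 0] is treated apart. *)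
have [<-|cN0] := eqVneq 0%R c.
  by rewrite mul0e; apply: esum_ge0 => x Sx; rewrite mul0e.
have {cN0}c0 : (0 < c)%R by rewrite lt_neqAle cN0.
rewrite -lee_pdivlMl//; apply: esum_le_seq => s us sS.
rewrite lee_pdivlMl// -sumM//; exact: esum_ge_seq.
Qed.

End ExtendedSums.

(** A finite sum commutes with [\esum] and is bounded termwise by the full sum. By symmetry this
    half of Tonelli's theorem gives the equality. *)
Lemma exchange_esum_le {R : realType} {I J : choiceType} (A : set I) (B : set J)
    (a : I -> J -> \bar R) : (forall i j, A i -> B j -> 0 <= a i j)%E ->
  (\esum_(i in A) \esum_(j in B) a i j <= \esum_(j in B) \esum_(i in A) a i j)%E.
Proof.
move=> a0; apply: esum_le_seq => s us sA.
rewrite big_seq -esum_sum; last by move=> j i Bj si; apply: a0 => //; exact: sA.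
by apply: le_esum => j Bj; rewrite -big_seq; exact: esum_ge_seq.
Qed.

Lemma exchange_esum {R : realType} {I J : choiceType} (A : set I) (B : set J)
    (a : I -> J -> \bar R) : (forall i j, A i -> B j -> 0 <= a i j)%E ->
  (\esum_(i in A) \esum_(j in B) a i j = \esum_(j in B) \esum_(i in A) a i j)%E.
Proof.
by move=> a0; apply/eqP; rewrite eq_le !exchange_esum_le// => j i Bj Ai; exact: a0.
Qed.

(** * The Markov operator of a random move, and its iterates *)

Section Averages.
Context {R : realType} {T : choiceType} {M : finType}.
Variables (act : M -> T -> T) (q : M -> R) (G : set T).
Hypothesis q_ge0 : forall m, 0 <= q m.
Hypothesis q_sum1 : \sum_m q m = 1.
Hypothesis act_closed : forall m x, G x -> G (act m x).

Definition avg (f : T -> R) (x : T) : R := \sum_m q m * f (act m x).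

Lemma avgE f x : avg f x = \sum_m q m * f (act m x). Proof. by []. Qed.

Lemma avg_le n (f g : T -> R) : (forall x, G x -> f x <= g x) ->
  forall x, G x -> iter n avg f x <= iter n avg g x.
Proof.
move=> fg; elim: n => [//|n IH] x Gx /=.
by apply: ler_sum => m _; apply: ler_wpM2l => //; exact/IH/act_closed.
Qed.

Lemma avg_cst n (c : R) : iter n avg (fun=> c) = fun=> c.
Proof.
elim: n => [//|n IH]; apply/funext => x.
by rewrite iterS IH /avg -mulr_suml q_sum1 mul1r.
Qed.

Lemma avg_sum n (I : Type) (s : seq I) (c : I -> R) (f : I -> T -> R) x :
  iter n avg (fun x => \sum_(i <- s) c i * f i x) x =
  \sum_(i <- s) c i * iter n avg (f i) x.
Proof.
elim: n x => [//|n IH] x /=; rewrite avgE.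
transitivity (\sum_m \sum_(i <- s) q m * (c i * iter n avg (f i) (act m x))).
  by apply: eq_bigr => m _; rewrite IH mulr_sumr.
rewrite exchange_big; apply: eq_bigr => i _ /=; rewrite avgE mulr_sumr.
by apply: eq_bigr => m _; rewrite mulrCA.
Qed.

Lemma avg_affine n (a b : R) (f : T -> R) x :
  iter n avg (fun x => a + b * f x) x = a + b * iter n avg f x.
Proof.
elim: n x => [//|n IH] x /=; rewrite !avgE.
transitivity (\sum_m (q m * a + q m * (b * iter n avg f (act m x)))).
  by apply: eq_bigr => m _; rewrite IH mulrDr.
rewrite big_split /= -mulr_suml q_sum1 mul1r; congr (_ + _).
by rewrite mulr_sumr; apply: eq_bigr => m _; rewrite mulrCA.
Qed.

Lemma avg_bound n (a b : R) (f : T -> R) : (forall x, G x -> a <= f x <= b) ->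
  forall x, G x -> a <= iter n avg f x <= b.
Proof.
move=> fab x Gx; rewrite -{1}[a]/((fun=> a) x) -{1}(avg_cst n a).
rewrite -[X in _ && (_ <= X)]/((fun=> b) x) -(avg_cst n b).
by apply/andP; split; apply: avg_le => // y /fab/andP[].
Qed.

(** The right-hand side sums over all words of length [size s]; for [f >= 0] all of them but [s] may
    be dropped. *)
Lemma avg_word (s : seq M) (f : T -> R) : (forall x, G x -> 0 <= f x) ->
  forall x, G x ->
  (\prod_(m <- s) q m) * f (foldl (fun z m => act m z) x s)
    <= iter (size s) avg f x.
Proof.
move=> f0; elim: s => [|m s IH] x Gx; first by rewrite big_nil mul1r.
rewrite big_cons /= /avg (bigD1 m)//= -mulrA.
have nf y : G y -> 0 <= iter (size s) avg f y.
  by move=> Gy; have := avg_le (size s) _ _ f0 _ Gy; rewrite avg_cst.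
apply: le_trans (ler_wpM2l (q_ge0 m) (IH _ (act_closed m _ Gx))) _.
rewrite lerDl; apply: sumr_ge0 => k _; apply: mulr_ge0 => //.
exact/nf/act_closed.
Qed.

Fixpoint reach (n : nat) (x : T) : seq T :=
  if n is n'.+1 then flatten [seq reach n' (act m x) | m <- enum M] else [:: x].

Lemma reach_closed n x y : G x -> y \in reach n x -> G y.
Proof.
elim: n x => [|n IH] x Gx /=; first by rewrite inE => /eqP ->.
by case/flatten_mapP => m _; apply: IH; exact: act_closed.
Qed.

Lemma avg_reach n (f : T -> R) x : (forall y, y \in reach n x -> f y = 1) ->
  iter n avg f x = 1.
Proof.
elim: n x => [|n IH] x f1 /=; first by rewrite f1//= inE.
rewrite -q_sum1 /avg; apply: eq_bigr => m _; rewrite IH ?mulr1// => y ys.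
by apply: f1; apply/flatten_mapP; exists m => //; rewrite mem_enum.
Qed.

(** * Doeblin's condition and geometric decay of oscillations *)

Variables (L : nat) (eps : R) (o : T).
Hypothesis L_gt0 : (0 < L)%N.
Hypothesis eps_gt0 : 0 < eps.
Hypothesis Go : G o.
Hypothesis minorisation : forall f : T -> R, (forall x, G x -> 0 <= f x) ->
  forall x, G x -> eps * f o <= iter L avg f x.

(** Stands in for the [L]-th root of [1 - eps], which vanishes if [eps = 1]; the exponential stays
    positive, so that [oscC] can divide by its powers. *)
Definition ratio : R := expR (- (eps / L%:R)).

(** Pays for the fewer than [L] steps left over when the steps are grouped into blocks of [L]. *)
Definition oscC : R := ratio ^- L.

Lemma ratio_gt0 : 0 < ratio. Proof. exact: expR_gt0. Qed.

Lemma ratio_lt1 : ratio < 1.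
Proof. by rewrite expR_lt1 oppr_lt0 divr_gt0// ltr0n. Qed.

Lemma ratioL : 1 - eps <= ratio ^+ L.
Proof.
rewrite -expRM_natl mulrN mulrCA divff ?mulr1; last by rewrite pnatr_eq0 -lt0n.
exact: expR_ge1Dx.
Qed.

Lemma oscC_gt0 : 0 < oscC.
Proof. by rewrite invr_gt0 exprn_gt0// ratio_gt0. Qed.

Lemma avg_contract (a b : R) (f : T -> R) : (forall x, G x -> a <= f x <= b) ->
  exists a' b', (forall x, G x -> a' <= iter L avg f x <= b') /\
    b' - a' = (1 - eps) * (b - a).
Proof.
(* The two bounds are the minorisation applied to the nonnegative functions [f - a] and [b - f]; the
   terms in [f o] cancel in the difference. *)
move=> fab; exists (a + eps * (f o - a)), (b - eps * (b - f o)); split; last first.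
  by ring.
move=> x Gx.
have := minorisation (fun x => - a + 1 * f x) _ x Gx.
have := minorisation (fun x => b + (-1) * f x) _ x Gx.
rewrite !avg_affine => h1 h2; apply/andP; split.
  suff : forall y, G y -> 0 <= - a + 1 * f y by move/h2; lra.
  by move=> y /fab/andP[? ?]; lra.
suff : forall y, G y -> 0 <= b + -1 * f y by move/h1; lra.
by move=> y /fab/andP[? ?]; lra.
Qed.

Lemma avg_osc n (a b : R) (f : T -> R) : (forall x, G x -> a <= f x <= b) ->
  exists a' b', (forall x, G x -> a' <= iter n avg f x <= b') /\
    b' - a' <= (b - a) * (oscC * ratio ^+ n).
Proof.
(* Strong induction on [n], removing [L] steps at a time. Below [L] the trivial bounds do, since
   [oscC * ratio ^+ n >= 1] there. *)
have [k] := ubnP n; elim: k n a b f => // k IH n a b f; rewrite ltnS => nk fab.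
have ab : 0 <= b - a by have /andP[] := fab _ Go; lra.
have [nL|Ln] := ltnP n L.
  exists a, b; split; first exact: avg_bound.
  rewrite ler_peMr// /oscC mulrC ler_pdivlMr ?exprn_gt0 ?ratio_gt0// mul1r.
  by apply: ler_wiXn2l; [exact/ltW/ratio_gt0|exact/ltW/ratio_lt1|exact: ltnW].
have [a1 [b1 [f1 d1]]] := avg_contract _ _ _ fab.
have nLk : (n - L < k)%N.
  by rewrite (leq_trans _ nk)// ltn_subrL L_gt0 (leq_trans L_gt0).
have [a' [b' [f' d']]] := IH _ _ _ _ nLk f1.
exists a', b'; split.
  by move=> x Gx; rewrite -(subnK Ln) iterD; exact: f'.
apply: (le_trans d'); rewrite d1 mulrAC mulrC; apply: ler_wpM2l => //.
rewrite mulrCA; apply: ler_wpM2l; first exact/ltW/oscC_gt0.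
rewrite -[in leRHS](subnK Ln) exprD mulrC.
by apply: ler_wpM2l; [rewrite exprn_ge0// ltW// ratio_gt0|exact: ratioL].
Qed.

Definition in01 (f : T -> R) := forall x, G x -> 0 <= f x <= 1.

(** Further averaging keeps the values of the [n]-th iterate in the same interval, whose length
    [avg_osc] controls. With [x = o] this is a Cauchy estimate. *)
Lemma avg_osc01 n m (f : T -> R) x : in01 f -> G x ->
  `|iter n avg f x - iter (m + n) avg f o| <= oscC * ratio ^+ n.
Proof.
move=> f01 Gx; have [a [b [fab d]]] := avg_osc n _ _ _ f01.
have /andP[? ?] := fab _ Gx; have := avg_bound m _ _ _ fab _ Go.
by rewrite -iterD ler_norml => /andP[? ?]; apply/andP; split; lra.
Qed.

(** * The limiting functional *)

Definition eqlim (f : T -> R) : R := limn (fun n => iter n avg f o).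

Lemma cvg_rate : (fun n => oscC * ratio ^+ n) @ \oo --> (0 : R).
Proof.
rewrite -[X in _ --> X](mulr0 oscC); apply: cvgMl_tmp.
by apply: cvg_expr; rewrite gtr0_norm ?ratio_gt0// ratio_lt1.
Qed.

Lemma cvg_eqlim f : in01 f -> (fun n => iter n avg f o) @ \oo --> eqlim f.
Proof.
move=> f01; apply/cauchy_cvgP/cauchy_exP => e e0.
have [n _ nlt] : \forall n \near \oo, oscC * ratio ^+ n < e.
  exact: cvgr_lt cvg_rate _ e0.
exists (iter n avg f o); exists n => // m /= nm; rewrite /ball /= -(subnK nm).
exact: le_lt_trans (avg_osc01 _ _ _ _ f01 Go) (nlt _ (leqnn n)).
Qed.

(** Let [m] tend to infinity in [avg_osc01]. In particular the limit does not depend on the starting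
    point. *)
Lemma avg_eqlim n f x : in01 f -> G x ->
  `|iter n avg f x - eqlim f| <= oscC * ratio ^+ n.
Proof.
move=> f01 Gx.
have c : (fun m => `|iter n avg f x - iter (m + n) avg f o|) @ \oo -->
    `|iter n avg f x - eqlim f|.
  apply: cvg_norm; apply: cvgB; first exact: cvg_cst.
  by rewrite (cvg_shiftn n (fun m => iter m avg f o)); exact: cvg_eqlim.
rewrite -(cvg_lim _ c)//; apply: limr_le; first by apply/cvg_ex; eexists; exact: c.
by apply: nearW => m; exact: avg_osc01.
Qed.

Lemma le0_rate (c : R) : (forall n, c <= oscC * ratio ^+ n) -> c <= 0.
Proof. by move=> h; apply: (cvgr_to_ge cvg_rate); exact: nearW. Qed.

Lemma cvg_avg_sum (I : eqType) (s : seq I) (c : I -> R) (f : I -> T -> R) :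
  (forall i, i \in s -> in01 (f i)) ->
  (fun n => iter n avg (fun x => \sum_(i <- s) c i * f i x) o) @ \oo -->
    \sum_(i <- s) c i * eqlim (f i).
Proof.
move=> f01.
rewrite (_ : (fun n => _) = fun n => \sum_(i <- s) c i * iter n avg (f i) o).
  rewrite big_seq (_ : (fun n => _) =
      fun n => \sum_(i <- s | i \in s) c i * iter n avg (f i) o).
    apply: (@cvg_big _ _ +%R); first exact: add_continuous.
    by move=> i si; apply: cvgMl_tmp; exact/cvg_eqlim/f01.
  by apply/funext => n; rewrite big_seq.
by apply/funext => n; rewrite avg_sum.
Qed.

Lemma eqlim_sum (I : eqType) (s : seq I) (c : I -> R) (f : I -> T -> R) :
  (forall i, i \in s -> in01 (f i)) ->
  eqlim (fun x => \sum_(i <- s) c i * f i x) = \sum_(i <- s) c i * eqlim (f i).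
Proof. by move=> f01; apply: cvg_lim => //; exact: cvg_avg_sum. Qed.

Lemma eqlim_le f g : in01 f -> in01 g -> (forall x, G x -> f x <= g x) ->
  eqlim f <= eqlim g.
Proof.
move=> f01 g01 fg; apply: ler_lim.
- by apply/cvg_ex; eexists; exact: cvg_eqlim f01.
- by apply/cvg_ex; eexists; exact: cvg_eqlim g01.
by apply: nearW => n; exact: avg_le.
Qed.

Lemma eqlim_cst (c : R) : eqlim (fun=> c) = c.
Proof.
rewrite /eqlim (_ : (fun n => _) = fun=> c) ?lim_cst//.
by apply/funext => n; rewrite avg_cst.
Qed.

Lemma in01_cst (c : R) : 0 <= c <= 1 -> in01 (fun=> c).
Proof. by move=> c01 x _. Qed.

Lemma eqlim01 f : in01 f -> 0 <= eqlim f <= 1.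
Proof.
move=> f01; rewrite -{1}(eqlim_cst 0) -(eqlim_cst 1).
apply/andP; split; apply: eqlim_le => //;
  by [apply: in01_cst; rewrite ?lexx ler01|move=> x /f01/andP[]].
Qed.

Lemma in01_avg k f : in01 f -> in01 (iter k avg f).
Proof. by move=> f01 x Gx; exact: avg_bound. Qed.

(** Extra averaging only shifts the sequence whose limit is taken; stationarity comes from here. *)
Lemma eqlim_avg k f : in01 f -> eqlim (iter k avg f) = eqlim f.
Proof.
move=> f01; apply: cvg_lim => //.
rewrite (_ : (fun n => _) = fun n => iter (n + k) avg f o).
  by rewrite (cvg_shiftn k (fun m => iter m avg f o)); exact: cvg_eqlim.
by apply/funext => n; rewrite iterD.
Qed.

Lemma eqlimB f : in01 f -> eqlim (fun x => 1 + -1 * f x) = 1 - eqlim f.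
Proof.
move=> f01; apply: cvg_lim => //.
rewrite (_ : (fun n => _) = fun n => 1 - iter n avg f o).
  by apply: cvgB; [exact: cvg_cst|exact: cvg_eqlim].
by apply/funext => n; rewrite avg_affine mulN1r.
Qed.

(** * The limiting functional as a probability distribution *)

Definition ind (z x : T) : R := (x == z)%:R.

Lemma in01_ind z : in01 (ind z).
Proof. by move=> x _; rewrite /ind; case: eqP => _; rewrite ?lexx ?ler01. Qed.

Lemma sum_ind (s : seq T) (g : T -> R) x : uniq s ->
  \sum_(z <- s) g z * ind z x = if x \in s then g x else 0.
Proof.
move=> us; case: ifPn => xs.
  rewrite (bigD1_seq x)//= /ind eqxx mulr1 big1 ?addr0// => z /negPf.
  by rewrite eq_sym => ->; rewrite mulr0.
rewrite big_seq big1// => z zs; rewrite /ind; case: eqP => [xz|_].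
  by rewrite -xz (negPf xs) in zs.
by rewrite mulr0.
Qed.

Definition eqdist (z : T) : R := eqlim (ind z).

Lemma eqdist_ge0 z : 0 <= eqdist z.
Proof. by have /andP[] := eqlim01 _ (in01_ind z). Qed.

Lemma sum_eqdist (s : seq T) (g : T -> R) : uniq s ->
  \sum_(z <- s) g z * eqdist z = eqlim (fun x => if x \in s then g x else 0).
Proof.
move=> us; rewrite -eqlim_sum; last by move=> z _; exact: in01_ind.
by congr eqlim; apply/funext => x; rewrite sum_ind.
Qed.

Lemma in01_restr (s : seq T) g : in01 g ->
  in01 (fun x => if x \in s then g x else 0).
Proof. by move=> g01 x Gx; case: ifP => _; [exact: g01|rewrite lexx ler01]. Qed.

(** A finite partial sum is [eqlim] of [f] cut off outside a finite set, and the cut-off function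
    lies below [f]. *)
Lemma esum_eqdist_le f : in01 f ->
  (\esum_(z in G) (eqdist z)%:E * (f z)%:E <= (eqlim f)%:E)%E.
Proof.
move=> f01; apply: esum_le_seq => s us sG.
under eq_bigr do rewrite -EFinM mulrC.
rewrite sumEFin lee_fin sum_eqdist//; apply: eqlim_le => //.
  exact: in01_restr.
by move=> x Gx; case: ifP => // _; have /andP[] := f01 _ Gx.
Qed.

(* No mass escapes: started at [o], the chain stays in the finite set [reach n o]
   for [n] steps, whose [eqdist]-mass is thus at least [1 - oscC * ratio ^+ n]. *)
Lemma esum_eqdist : (\esum_(z in G) (eqdist z)%:E = 1)%E.
Proof.
have c01 : in01 (fun=> 1) by apply: in01_cst; rewrite lexx ler01.
apply/eqP; rewrite eq_le; apply/andP; split.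
  have := esum_eqdist_le _ c01; rewrite eqlim_cst; apply: le_trans.
  by apply: le_esum => z _; rewrite mule1.
have key n : ((1 - oscC * ratio ^+ n)%:E <= \esum_(z in G) (eqdist z)%:E)%E.
  pose s := undup (reach n o); pose g x : R := if x \in s then 1 else 0.
  have g01 : in01 g by exact: in01_restr.
  have g1 : iter n avg g o = 1.
    by apply: avg_reach => y yr; rewrite /g mem_undup yr.
  have := avg_eqlim n _ _ g01 Go; rewrite g1 ler_norml => /andP[_ gn].
  apply: (@le_trans _ _ (eqlim g)%:E); first by rewrite lee_fin; lra.
  rewrite -(sum_eqdist s (fun=> 1)) ?undup_uniq// -sumEFin.
  under eq_bigr do rewrite mul1r.
  apply: esum_ge_seq; rewrite ?undup_uniq// => x.
  rewrite mem_undup; exact: reach_closed.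
move: key; case: (\esum_(z in G) _)%E => [c||] key; last 2 first.
- exact: leey.
- by have := key 0%N; rewrite leeNy_eq.
rewrite lee_fin -subr_le0; apply: le0_rate => n.
by have := key n; rewrite lee_fin; lra.
Qed.

(* [esum_eqdist_le] for [f] and for [1 - f], whose two sides both add up to 1. *)
Lemma esum_eqdistE f : in01 f ->
  (\esum_(z in G) (eqdist z)%:E * (f z)%:E = (eqlim f)%:E)%E.
Proof.
move=> f01; pose g x := 1 + -1 * f x.
have g01 : in01 g by move=> x /f01 /andP[? ?]; rewrite /g; lra.
have := esum_eqdist_le _ g01; have := esum_eqdist_le _ f01.
have : (\esum_(z in G) (eqdist z)%:E * (f z)%:E +
        \esum_(z in G) (eqdist z)%:E * (g z)%:E = 1)%E.
  rewrite -esum_eqdist -esumD.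
  - apply: eq_esum => z Gz; rewrite -!EFinM -EFinD; congr EFin.
    by rewrite /g; ring.
  - by move=> z /f01/andP[? _]; rewrite -EFinM lee_fin mulr_ge0// eqdist_ge0.
  - by move=> z /g01/andP[? _]; rewrite -EFinM lee_fin mulr_ge0// eqdist_ge0.
rewrite (eqlimB _ f01).
case: (\esum_(z in G) _)%E => [a||]; case: (\esum_(z in G) _)%E => [b||] //=.
by rewrite !lee_fin => -[] ? ? ?; congr EFin; lra.
Qed.


(** * Sampling after a random number of steps *)

Variables (w : nat -> R) (delta : R).
Hypothesis w_ge0 : forall k, 0 <= w k.
Hypothesis w_sum1 : (\esum_(k in [set: nat]) (w k)%:E = 1)%E.
(** [delta] is the generating function of [w] at [ratio]: the geometric rate averaged over the
    number of steps. *)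
Hypothesis w_ratio : (\esum_(k in [set: nat]) (w k * ratio ^+ k)%:E = delta%:E)%E.

Definition mixed (f : T -> R) (x : T) : \bar R :=
  (\esum_(k in [set: nat]) (w k * iter k avg f x)%:E)%E.

(* Expectation of [f] started from [nu], after a random number of steps that has
   law [w]. *)
Definition sampled (nu : T -> R) (f : T -> R) : \bar R :=
  (\esum_(x in G) (nu x)%:E * mixed f x)%E.

Lemma avg_ge0 k f x : (forall y, G y -> 0 <= f y) -> G x -> 0 <= iter k avg f x.
Proof. by move=> f0 Gx; have := avg_le k _ _ f0 _ Gx; rewrite avg_cst. Qed.

Lemma w_avg_ge0 k f x : (forall y, G y -> 0 <= f y) -> G x ->
  (0 <= (w k * iter k avg f x)%:E)%E.
Proof. by move=> f0 Gx; rewrite lee_fin mulr_ge0// avg_ge0. Qed.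

Lemma mixed_ge0 f x : (forall y, G y -> 0 <= f y) -> G x -> (0 <= mixed f x)%E.
Proof. by move=> f0 Gx; apply: esum_ge0 => k _; exact: w_avg_ge0. Qed.

Lemma rate_ge0 k : 0 <= ratio ^+ k.
Proof. exact/exprn_ge0/ltW/ratio_gt0. Qed.

Lemma delta_ge0 : 0 <= delta.
Proof.
by rewrite -lee_fin -w_ratio; apply: esum_ge0 => k _; rewrite lee_fin mulr_ge0// rate_ge0.
Qed.

Lemma oscCdelta_ge0 : 0 <= oscC * delta.
Proof. by rewrite mulr_ge0 ?delta_ge0// ltW// oscC_gt0. Qed.

Lemma esum_w_affine (a b : R) : 0 <= a -> 0 <= b ->
  (\esum_(k in [set: nat]) (w k * (a + b * ratio ^+ k))%:E = (a + b * delta)%:E)%E.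
Proof.
move=> a0 b0.
rewrite (@eq_esum _ _ _ _ (fun k => a%:E * (w k)%:E + b%:E * (w k * ratio ^+ k)%:E)%E).
  rewrite esumD; last 2 first.
  - by move=> k _; rewrite -EFinM lee_fin mulr_ge0.
  - by move=> k _; rewrite -EFinM lee_fin !mulr_ge0// rate_ge0.
  rewrite !ge0_esumZl//.
  - by rewrite w_sum1 w_ratio mule1.
  - by move=> k _; rewrite lee_fin mulr_ge0// rate_ge0.
  - by move=> k _; rewrite lee_fin.
by move=> k _; rewrite -!EFinM -EFinD; congr EFin; ring.
Qed.

Lemma mixed_le f x : in01 f -> G x -> (mixed f x <= (eqlim f + oscC * delta)%:E)%E.
Proof.
move=> f01 Gx; have /andP[l0 _] := eqlim01 _ f01.
rewrite -esum_w_affine//; last exact/ltW/oscC_gt0.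
apply: le_esum => k _; rewrite lee_fin ler_wpM2l//.
by have := avg_eqlim k _ _ f01 Gx; rewrite ler_norml; lra.
Qed.

(** The error term stands on the right so that every sum has nonnegative terms and [esumD]
    applies. *)
Lemma mixed_ge f x : in01 f -> G x -> ((eqlim f)%:E <= mixed f x + (oscC * delta)%:E)%E.
Proof.
move=> f01 Gx.
have -> : (oscC * delta)%:E =
    (\esum_(k in [set: nat]) (w k * (0 + oscC * ratio ^+ k))%:E)%E.
  by rewrite esum_w_affine ?add0r// ltW// oscC_gt0.
have /andP[l0 _] := eqlim01 _ f01.
have -> : (eqlim f)%:E = (\esum_(k in [set: nat]) (w k * (eqlim f + 0 * ratio ^+ k))%:E)%E.
  by rewrite esum_w_affine// mul0r addr0.
rewrite -esumD.
- apply: le_esum => k _; rewrite -EFinD lee_fin -mulrDr ler_wpM2l//.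
  by have := avg_eqlim k _ _ f01 Gx; rewrite ler_norml; lra.
- by move=> k _; apply: w_avg_ge0 => // y /f01/andP[].
- by move=> k _; rewrite lee_fin add0r !mulr_ge0// ?rate_ge0// ltW// oscC_gt0.
Qed.

Definition distribution (nu : T -> R) : Prop :=
  (forall x, 0 <= nu x) /\ (\esum_(x in G) (nu x)%:E = 1)%E.

Lemma esum_distribution nu (c : R) : distribution nu -> 0 <= c ->
  (\esum_(x in G) (nu x)%:E * c%:E = c%:E)%E.
Proof.
move=> [nu0 nu1] c0; under eq_esum do rewrite muleC.
by rewrite ge0_esumZl// ?nu1 ?mule1// => x _; rewrite lee_fin.
Qed.

Lemma sampled_le nu f : distribution nu -> in01 f ->
  (sampled nu f <= (eqlim f + oscC * delta)%:E)%E.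
Proof.
move=> nud f01; have /andP[l0 _] := eqlim01 _ f01.
rewrite -(esum_distribution nu)//; last by rewrite addr_ge0// oscCdelta_ge0.
by apply: le_esum => x Gx; apply: lee_wpmul2l; [rewrite lee_fin; case: nud|exact: mixed_le].
Qed.

Lemma sampled_ge nu f : distribution nu -> in01 f ->
  ((eqlim f)%:E <= sampled nu f + (oscC * delta)%:E)%E.
Proof.
move=> nud f01; have /andP[l0 _] := eqlim01 _ f01.
have f0 y : G y -> 0 <= f y by move=> /f01/andP[].
have d0 : (0 <= (oscC * delta)%:E)%E by rewrite lee_fin oscCdelta_ge0.
have nu0 x : (0 <= (nu x)%:E)%E by rewrite lee_fin; case: nud.
rewrite -(esum_distribution nu (eqlim f))// -(esum_distribution nu (oscC * delta))//.
rewrite -esumD.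
- apply: le_esum => x Gx; rewrite -ge0_muleDr//; last exact: mixed_ge0.
  by apply: lee_wpmul2l => //; exact: mixed_ge.
- by move=> x Gx; rewrite mule_ge0// mixed_ge0.
- by move=> x Gx; rewrite mule_ge0.
Qed.

Lemma sampled_ge0 nu f : distribution nu -> in01 f -> (0 <= sampled nu f)%E.
Proof.
move=> [nu0 _] f01; apply: esum_ge0 => x Gx; apply: mule_ge0; first by rewrite lee_fin.
by apply: mixed_ge0 => // y /f01/andP[].
Qed.

Lemma sampled_sum nu (s : seq T) : distribution nu ->
  sampled nu (fun x => \sum_(z <- s) 1 * ind z x) =
  (\sum_(z <- s) sampled nu (ind z))%E.
Proof.
move=> [nu0 _]; have i0 z y : G y -> 0 <= ind z y by move=> /(in01_ind z)/andP[].
rewrite -esum_sum; last first.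
  by move=> x z Gx _; apply: mule_ge0; [rewrite lee_fin|apply: mixed_ge0 => //; exact: i0].
apply: eq_esum => x Gx; rewrite -ge0_sume_distrr; last first.
  by move=> z _; apply: mixed_ge0 => //; exact: i0.
congr (_ * _)%E; rewrite -esum_sum; last first.
  by move=> k z _ _; apply: w_avg_ge0 => //; exact: i0.
apply: eq_esum => k _; rewrite avg_sum sumEFin mulr_sumr.
by congr EFin; apply: eq_bigr => z _; rewrite mul1r.
Qed.

(** Exchange the sums over states and over step counts: for each [k] the inner sum is
    [eqlim (iter k avg f) = eqlim f], and the weights add up to 1. *)
Lemma sampled_eqdist f : in01 f -> sampled eqdist f = (eqlim f)%:E.
Proof.
move=> f01; have f0 y : G y -> 0 <= f y by move=> /f01/andP[].
have /andP[l0 _] := eqlim01 _ f01.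
transitivity (\esum_(x in G) \esum_(k in [set: nat])
    (w k)%:E * ((eqdist x)%:E * (iter k avg f x)%:E))%E.
  apply: eq_esum => x Gx; rewrite -ge0_esumZl ?eqdist_ge0//.
    by apply: eq_esum => k _; rewrite EFinM muleCA.
  by move=> k _; exact: w_avg_ge0.
rewrite exchange_esum; last first.
  by move=> x k Gx _; rewrite -!EFinM lee_fin !mulr_ge0// ?eqdist_ge0// avg_ge0.
transitivity (\esum_(k in [set: nat]) (w k)%:E * (eqlim f)%:E)%E.
  apply: eq_esum => k _; rewrite ge0_esumZl//.
    by rewrite esum_eqdistE ?eqlim_avg//; exact: in01_avg.
  by move=> x Gx; rewrite -EFinM lee_fin mulr_ge0// ?eqdist_ge0// avg_ge0.
under eq_esum do rewrite muleC.
by rewrite ge0_esumZl// ?w_sum1 ?mule1// => k _; rewrite lee_fin.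
Qed.

Lemma sampled_tv nu : distribution nu ->
  (\esum_(z in G) `|sampled nu (ind z) - (eqdist z)%:E|
     <= (2 * oscC * delta)%:E)%E.
Proof.
move=> nud; pose l z := fine (sampled nu (ind z)).
have lE z : sampled nu (ind z) = (l z)%:E.
  rewrite fineK// ge0_fin_numE ?sampled_ge0//; last exact: in01_ind.
  by apply: le_lt_trans (sampled_le _ _ nud (in01_ind z)) _; exact: ltry.
(* The indicator of a finite set is a single test function with values in [0, 1], so the error does
   not grow with the set. *)
have sumE s : uniq s -> `|\sum_(z <- s) l z - \sum_(z <- s) eqdist z| <= oscC * delta.
  move=> us; have s01 : in01 (fun x => \sum_(z <- s) 1 * ind z x).
    move=> x _; rewrite (sum_ind s (fun=> 1))//.
    by case: ifP => _; rewrite ?lexx ?ler01.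
  have -> : \sum_(z <- s) eqdist z = eqlim (fun x => \sum_(z <- s) 1 * ind z x).
    rewrite eqlim_sum; last by move=> z _; exact: in01_ind.
    by apply: eq_bigr => z _; rewrite mul1r.
  have sE : sampled nu (fun x => \sum_(z <- s) 1 * ind z x) = (\sum_(z <- s) l z)%:E.
    by rewrite sampled_sum// -sumEFin; apply: eq_bigr => z _.
  have := sampled_le _ _ nud s01; have := sampled_ge _ _ nud s01.
  by rewrite sE -EFinD !lee_fin ler_norml => ? ?; apply/andP; split; lra.
apply: esum_le_seq => s us _; under eq_bigr do rewrite lE -EFinB abse_EFin.
(* Split by the sign of [l z - eqdist z]. On each part the absolute values add up to the absolute
   value of the sum; the two parts produce the factor 2. *)
rewrite sumEFin lee_fin (bigID (fun z => eqdist z <= l z))/= -mulrA mulr2n mulrDl mul1r.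
apply: lerD; rewrite -big_filter; set s' := [seq z <- s | _].
  apply: le_trans (sumE s' (filter_uniq _ us)); rewrite -sumrB ger0_norm.
    rewrite le_eqVlt; apply/orP; left; apply/eqP; rewrite big_seq [RHS]big_seq.
    by apply: eq_bigr => z; rewrite mem_filter => /andP[h _]; rewrite ger0_norm ?subr_ge0.
  by rewrite big_seq sumr_ge0// => z; rewrite mem_filter => /andP[h _]; rewrite subr_ge0.
apply: le_trans (sumE s' (filter_uniq _ us)); rewrite -sumrB ler0_norm.
  rewrite le_eqVlt; apply/orP; left; apply/eqP; rewrite -sumrN big_seq [RHS]big_seq.
  apply: eq_bigr => z; rewrite mem_filter -ltNge => /andP[h _].
  by rewrite ltr0_norm ?subr_lt0.
rewrite big_seq sumr_le0// => z; rewrite mem_filter -ltNge => /andP[h _].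
by rewrite subr_le0 ltW.
Qed.

End Averages.

(** * Effect of the moves on relative coordinates *)

Lemma normalize_min {N : nat} (x : 'I_N -> int) (k0 : 'I_N) :
  (forall i, x k0 <= x i) -> normalize x = [ffun k => `|x k - x k0|%N].
Proof.
move=> k0P; apply/ffunP => k; rewrite !ffunE; congr (`|_ - _|%N).
apply/le_anti/andP; split; first exact: bigmin_le.
by apply: le_bigmin => // i _.
Qed.

Lemma normalize_Gam {N : nat} (x : 'I_N -> int) (k : 'I_N) : Gam N (normalize x).
Proof.
case: (@arg_minP _ _ _ k xpredT x isT) => k0 _ k0P.
exists k0; rewrite (normalize_min x k0) ?ffunE ?subrr// => i; exact: k0P.
Qed.

Lemma step_Gam {N : nat} (m : move N) (y : state N) : Gam N y -> Gam N (step m y).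
Proof. by case=> k _; case: m => [[i|i]|[i j]] /=; exact: normalize_Gam. Qed.

Definition catch {N : nat} (k i : 'I_N) : move N := inr (i, k).

(** Particle [k] still sits at the minimum 0 after the move, so renormalizing subtracts nothing. If
    [y i] is already 0 the move is idle, in agreement with the formula. *)
Lemma step_catch {N : nat} (i k : 'I_N) (y : state N) : y k = 0%N ->
  step (catch k i) y = [ffun j => if j == i then 0%N else y j].
Proof.
move=> yk0 /=; rewrite (normalize_min _ k) yk0.
  apply/ffunP => j; rewrite !ffunE !if_same subr0.
  by have [->|] := eqVneq j i => //=; case: (y i).
by move=> j; rewrite if_same; case: ifP.
Qed.

Lemma run_catch {N : nat} (k : 'I_N) (s : seq 'I_N) (y : state N) : y k = 0%N ->
  run (map (catch k) s) y = [ffun j => if j \in s then 0%N else y j].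
Proof.
elim: s y => [|i s IH] y yk0; first by apply/ffunP => j; rewrite ffunE.
rewrite [LHS]/(run (map (catch k) s) (step (catch k i) y)).
rewrite step_catch// -[foldl _ _ _]/(run (map (catch k) s) _) IH ?ffunE ?yk0 ?if_same//.
by apply/ffunP => j; rewrite !ffunE inE; case: (j == i); case: (j \in s).
Qed.

(** * Uniformization of the particle system *)

Section Chain.
Context {R : realType} (alpha beta mu : R) (N : nat).
Hypothesis alpha_gt0 : 0 < alpha.
Hypothesis beta_gt0 : 0 < beta.
Hypothesis mu_gt0 : 0 < mu.
Hypothesis N_ge2 : (2 <= N)%N.

Local Notation rt := (@rate R alpha beta mu N).
Local Notation Lam := (total_rate alpha beta mu N).

Lemma N_gt0 : (0 < N)%N. Proof. exact: ltnW. Qed.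

Lemma move_rate_ge0 m : 0 <= rt m.
Proof.
case: m => [[i|i]|[i j]] /=; [exact: ltW|exact: ltW|].
by case: ifP => // _; rewrite divr_ge0// ltW.
Qed.

Lemma Lam_gt0 : 0 < Lam.
Proof.
rewrite /total_rate (bigD1 (inl (inl (Ordinal N_gt0))))//=.
by rewrite ltr_wpDr// sumr_ge0// => m _; exact: move_rate_ge0.
Qed.

Definition prob (m : move N) : R := rt m / Lam.

Lemma prob_ge0 m : 0 <= prob m.
Proof. by rewrite divr_ge0 ?move_rate_ge0// ltW// Lam_gt0. Qed.

Lemma prob_sum1 : \sum_m prob m = 1.
Proof. by rewrite -mulr_suml divff// gt_eqF// Lam_gt0. Qed.

Definition zero_state : state N := [ffun=> 0%N].

Lemma zero_Gam : Gam N zero_state.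
Proof. by exists (Ordinal N_gt0); rewrite ffunE. Qed.

Definition catch_prob : R := (mu / N%:R / Lam) ^+ N.-1.

Lemma catch_prob_gt0 : 0 < catch_prob.
Proof. by rewrite exprn_gt0// !divr_gt0// ?ltr0n ?N_gt0// Lam_gt0. Qed.

Lemma chain_minorisation (f : state N -> R) : (forall x, Gam N x -> 0 <= f x) ->
  forall x, Gam N x ->
  catch_prob * f zero_state <= iter N.-1 (avg (@step N) prob) f x.
Proof.
move=> f0 x Gx; have [k xk0] := Gx.
pose s : seq (move N) := map (catch k) (enum (predC1 k)).
have sz : size s = N.-1 by rewrite size_map -cardE cardC1 card_ord.
have := avg_word (@step N) prob (Gam N) prob_ge0 prob_sum1 (@step_Gam N) s f f0 x Gx.
rewrite sz -[foldl _ _ _]/(run s x) run_catch//.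
(* The word avoids [i = k], so each of its [N.-1] letters has rate [mu / N], not the diagonal value
   0. *)
rewrite (_ : \prod_(m <- s) prob m = catch_prob); last first.
  rewrite big_map big_seq (eq_bigr (fun=> mu / N%:R / Lam)); last first.
    by move=> i; rewrite mem_enum inE /prob /= => ->.
  by rewrite -big_seq big_const_seq count_predT -cardE cardC1 card_ord iter_mulr_1.
congr (_ * f _ <= _); apply/ffunP => j; rewrite !ffunE mem_enum inE.
by have [->|] := eqVneq j k.
Qed.

(** Induction on the first letter of the word; each letter contributes one factor [Lam], because
    [prob] is the rate divided by [Lam]. *)
Lemma sum_run k (f : state N -> R) x :
  \sum_(s : k.-tuple (move N)) (\prod_(m <- s) rt m) * f (run s x) =
  Lam ^+ k * iter k (avg (@step N) prob) f x.
Proof.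
elim: k x => [|k IH] x.
  rewrite (big_pred1 [tuple]); last by move=> s; apply/esym/eqP; exact: tuple0.
  by rewrite big_nil expr0 !mul1r.
rewrite (reindex (fun p : move N * k.-tuple (move N) => cons_tuple p.1 p.2))/=; last first.
  exists (fun s => (thead s, behead_tuple s)) => [[m s] _|s _] /=.
    by congr pair; exact/val_inj.
  by rewrite [RHS]tuple_eta; exact/val_inj.
rewrite -(pair_bigA _ (fun m (s : k.-tuple (move N)) =>
  (\prod_(i <- cons_tuple m s) rt i) * f (run (cons_tuple m s) x)))/=.
rewrite avgE mulr_sumr; apply: eq_bigr => m _.
transitivity (\sum_(s : k.-tuple (move N))
    rt m * ((\prod_(i <- s) rt i) * f (run s (step m x)))).
  by apply: eq_bigr => s _; rewrite big_cons mulrA.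
rewrite -mulr_sumr IH /prob exprSr; field.
by rewrite gt_eqF// Lam_gt0.
Qed.

(* [Lam ^+ k] compensates for the normalization of the rates in [prob]. *)
Definition poisson (t : R) (k : nat) : R :=
  expR (- Lam * t) * t ^+ k / k`!%:R * Lam ^+ k.

Lemma poisson_ge0 t k : 0 <= t -> 0 <= poisson t k.
Proof.
move=> t0; rewrite /poisson !mulr_ge0 ?expR_ge0 ?exprn_ge0//.
by rewrite ltW// Lam_gt0.
Qed.

Lemma esum_exp_coeff (x : R) : 0 <= x ->
  (\esum_(k in [set: nat]) (x ^+ k / k`!%:R)%:E = (expR x)%:E)%E.
Proof.
move=> x0; rewrite -nneseries_esumT; last first.
  by move=> k; rewrite lee_fin divr_ge0// exprn_ge0.
rewrite /expR -EFin_lim; last exact: is_cvg_series_exp_coeff.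
by congr (limn _); apply/funext => n; rewrite /= sumEFin.
Qed.

(** Generating function of the Poisson law of mean [Lam * t]. Its value at 1 gives the total mass,
    its value at [ratio] the exponential rate of convergence. *)
Lemma esum_poisson t r : 0 <= t -> 0 <= r ->
  (\esum_(k in [set: nat]) (poisson t k * r ^+ k)%:E =
   (expR (- (Lam * (1 - r)) * t))%:E)%E.
Proof.
move=> t0 r0; have x0 : 0 <= Lam * t * r by rewrite !mulr_ge0// ltW// Lam_gt0.
rewrite (_ : - (Lam * (1 - r)) * t = - Lam * t + Lam * t * r); last by ring.
rewrite expRD EFinM -(esum_exp_coeff (Lam * t * r))// -ge0_esumZl ?expR_ge0//; last first.
  by move=> k _; rewrite lee_fin divr_ge0// exprn_ge0.
apply: eq_esum => k _; rewrite -EFinM; congr EFin.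
by rewrite /poisson !exprMn; ring.
Qed.

Lemma lawE (nu : state N -> R) (t : R) (z : state N) :
  law alpha beta mu nu t z =
  sampled (@step N) prob (Gam N) (poisson t) nu (ind z).
Proof.
apply: eq_esum => x _; congr (_ * _)%E; apply: eq_esum => k _; congr EFin.
by rewrite (sum_run k (ind z)) mulrA.
Qed.

End Chain.

(** * Existence, uniqueness and exponential ergodicity *)

Theorem theorem2 (R : realType) (alpha beta mu : R) (N : nat) :
  0 < alpha -> 0 < beta -> 0 < mu -> (2 <= N)%N ->
  exists pi : state N -> R,
    stationary alpha beta mu pi /\
    (forall pi' : state N -> R, stationary alpha beta mu pi' ->
       forall y, Gam N y -> pi' y = pi y) /\
    exists C1 C2 : R, 0 < C1 /\ 0 < C2 /\
      forall t : R, 0 <= t -> forall nu : state N -> R, is_distribution nu ->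
        (\esum_(z in Gam N) `| law alpha beta mu nu t z - (pi z)%:E |
           <= (C1 * expR (- C2 * t))%:E)%E.
Proof.
move=> a0 b0 m0 N2.
pose Lam := total_rate alpha beta mu N.
have Lam0 : 0 < Lam by exact: Lam_gt0.
pose q := @prob R alpha beta mu N.
pose eps := @catch_prob R alpha beta mu N.
have q0 : forall m, 0 <= q m by exact: prob_ge0.
have q1 : \sum_m q m = 1 by exact: prob_sum1.
have L0 : (0 < N.-1)%N by rewrite -ltnS prednK// ltnW.
have eps0 : 0 < eps by exact: catch_prob_gt0.
have o0 : Gam N (zero_state N) by exact: zero_Gam.
have minor : forall f : state N -> R, (forall x, Gam N x -> 0 <= f x) ->
    forall x, Gam N x -> eps * f (zero_state N) <= iter N.-1 (avg (@step N) q) f x.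
  exact: chain_minorisation.
pose r := ratio N.-1 eps; pose C := oscC N.-1 eps.
have r0 : 0 < r by exact: ratio_gt0.
have r1 : r < 1 by exact: ratio_lt1.
have C0 : 0 < C by exact: oscC_gt0.
pose pi := eqdist (@step N) q (zero_state N).
have w0 t : 0 <= t -> forall k, 0 <= @poisson R alpha beta mu N t k.
  by move=> t0 k; exact: poisson_ge0.
have w1 t : 0 <= t ->
    (\esum_(k in [set: nat]) (@poisson R alpha beta mu N t k)%:E = 1)%E.
  move=> t0; rewrite -[RHS]/(1%:E) -(expR0 R).
  rewrite (_ : 0 = - (Lam * (1 - 1)) * t); last by ring.
  rewrite -esum_poisson//; apply: eq_esum => k _.
  by rewrite expr1n mulr1.
have wr t : 0 <= t ->
    (\esum_(k in [set: nat]) (@poisson R alpha beta mu N t k * r ^+ k)%:E =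
     (expR (- (Lam * (1 - r)) * t))%:E)%E.
  by move=> t0; rewrite esum_poisson// ltW.
have tv t nu : 0 <= t -> is_distribution nu ->
    (\esum_(z in Gam N) `| law alpha beta mu nu t z - (pi z)%:E |
       <= (2 * C * expR (- (Lam * (1 - r)) * t))%:E)%E.
  move=> t0 nud; under eq_esum do rewrite lawE//.
  exact: (sampled_tv _ _ _ q0 q1 (@step_Gam N) _ _ _ L0 eps0 o0 minor _ _ (w0 _ t0) (w1 _ t0) (wr _ t0)).
have C2_gt0 : 0 < Lam * (1 - r) by rewrite mulr_gt0// subr_gt0.
exists pi; split; [split|split].
- split; first by move=> x; exact: (eqdist_ge0 _ _ _ q0 q1 (@step_Gam N) _ _ _ L0 eps0 o0 minor).
  exact: (esum_eqdist _ _ _ q0 q1 (@step_Gam N) _ _ _ L0 eps0 o0 minor).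
- move=> t t0 z _; rewrite lawE//.
  exact: (sampled_eqdist _ _ _ q0 q1 (@step_Gam N) _ _ _ L0 eps0 o0 minor _ (w0 _ t0) (w1 _ t0) _ (in01_ind _ z)).
- move=> pi' [pi'd pi's] y Gy.
  (* Started from [pi'] the law at any time is [pi'] itself, so the total variation bound,
     restricted to the single state [y], holds for all [t]. *)
  have bd t : 0 <= t -> `|pi' y - pi y| <= 2 * C * expR (- (Lam * (1 - r)) * t).
    move=> t0; rewrite -lee_fin; apply: le_trans (tv t pi' t0 pi'd).
    have ys x : x \in [:: y] -> Gam N x by rewrite inE => /eqP ->.
    apply: le_trans (esum_ge_seq (Gam N) _ [:: y] isT ys).
    by rewrite big_seq1 pi's.
  apply/eqP; rewrite -subr_eq0 -normr_eq0; apply/eqP/le_anti; rewrite normr_ge0 andbT.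
  rewrite leNgt; apply/negP; set d := `|_| => d0.
  (* Chosen so that [d * (Lam * (1 - r) * t) = 2 * C]: then [1 + x <= expR x] turns [bd] into
     [d + 2 * C <= 2 * C], against [d > 0]. *)
  pose t := 2 * C / (Lam * (1 - r) * d).
  have t0 : 0 <= t by apply/ltW/divr_gt0; exact: mulr_gt0.
  have := bd t t0; rewrite -/d mulNr expRN ler_pdivlMr ?expR_gt0// => h.
  have tE : d * (Lam * (1 - r) * t) = 2 * C.
    by rewrite /t; field; rewrite !gt_eqF// subr_gt0.
  have := le_trans (ler_wpM2l (ltW d0) (expR_ge1Dx (Lam * (1 - r) * t))) h.
  by rewrite mulrDr tE mulr1; lra.
exists (2 * C), (Lam * (1 - r)); split; first by rewrite mulr_gt0.
by split=> // t t0 nu nud; exact: tv.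
Qed.
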